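(* Let $R^{*}\in\mathbb{R}^{m_T\times m_S}$ be any target block. For every network whose $K_{ff}$ is symmetric and invertible at every admissible stiffness vector (passive networks included), whatever its size and topology, and for every admissible stiffness vector $k$, $$\bigl\|R(k)-R^{*}\bigr\|_F\;\ge\;\bigl\|\Pi_{\mathcal{A}_P}R^{*}\bigr\|_F\;=\;\tfrac12\bigl\|B-B^{T}\bigr\|_F,$$ where $B=R^{*}[\tau(P),\sigma(P)]$ is the $p\times p$ restriction of the target to the shared degrees of freedom, rows and columns indexed by $P$ in one common order.
   Context: Network: $N$ point nodes at positions $x_i\in\mathbb{R}^2$ are joined by $n_b$ bonds. For a bond $b=(i,j)$ of length $L_b=|x_j-x_i|>0$ let $\hat n_b=(x_j-x_i)/L_b$ and let $\hat t_b$ be $\hat n_b$ rotated by $+90^\circ$. The vector $q_b\in\mathbb{R}^{2N}$ carries $-\hat n_b$ at node $i$, $+\hat n_b$ at node $j$ and zeros elsewhere; $s_b$ is defined identically with $\hat t_b$ in place of $\hat n_b$. For stiffnesses $k=(k_b)$ and odd couplings $a=(a_b)\in\mathbb{R}^{n_b}$ (fixed here) put $K=\sum_b(k_bq_b+a_bs_b)q_b^{T}$. Three degrees of freedom are pinned to remove the planar rigid-body modes; $K_{ff}$ is the restriction of $K$ to the remaining $n_{\mathrm{free}}=2N-3$ free degrees of freedom, and $C=K_{ff}^{-1}$. A stiffness vector $k$ is admissible if $k_b>0$ for every $b$ and $K_{ff}$ is invertible. Passive means $a\equiv0$ and $K_{ff}\succ0$. Response block: $S$ (driven) and $T$ (read)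 are sets of free degrees of freedom, $|S|=m_S$, $|T|=m_T$, $P=T\cap S$, $p=|P|$, $R(k)=C[T,S]\in\mathbb{R}^{m_T\times m_S}$. The injections $\tau:P\to\{1,\dots,m_T\}$ and $\sigma:P\to\{1,\dots,m_S\}$ give the position of each element of $P$ inside $T$ and inside $S$. $\mathcal{S}_P=\{A\in\mathbb{R}^{m_T\times m_S}: A_{\tau(r)\sigma(c)}=A_{\tau(c)\sigma(r)}\ \forall r,c\in P\}$, and $\mathcal{A}_P=\mathcal{S}_P^{\perp}$ (trace inner product), spanned by the matrices $E_{\tau(r)\sigma(c)}-E_{\tau(c)\sigma(r)}$, $E_{ij}$ being matrix units. $\Pi_{\mathcal{A}_P}$ is the orthogonal projection onto $\mathcal{A}_P$ and $\|\cdot\|_F$ the Frobenius norm. *)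

(* Defs.v *)
From HB Require Import structures.
From mathcomp Require Import all_boot all_order all_algebra.

Set Implicit Arguments.
Unset Strict Implicit.
Unset Printing Implicit Defensive.

Import Order.TTheory GRing.Theory Num.Theory.
Local Open Scope ring_scope.

Definition frobdot (R : rcfType) (m n : nat) (A B : 'M[R]_(m, n)) : R :=
  \tr (A^T *m B).

Definition frobnorm (R : rcfType) (m n : nat) (A : 'M[R]_(m, n)) : R :=
  Num.sqrt (frobdot A A).

Section FrobeniusDot.
Variables (R : rcfType) (m n : nat).
Implicit Types A B : 'M[R]_(m, n).

Lemma frobdotE A B : frobdot A B = \sum_i \sum_j A i j * B i j.
Proof.
rewrite /frobdot /mxtrace exchange_big; apply: eq_bigr => j _.
by rewrite !mxE; apply: eq_bigr => i _; rewrite mxE.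
Qed.

Lemma frobdot_bilinear : bilinear_for
  (GRing.Scale.Law.clone _ _ *%R _) (GRing.Scale.Law.clone _ _ *%R _)
  (@frobdot R m n).
Proof.
split=> [B|A] a X Y /=; rewrite /frobdot.
  by rewrite linearP mulmxDl -scalemxAl mxtraceD mxtraceZ.
by rewrite mulmxDr -scalemxAr mxtraceD mxtraceZ.
Qed.

HB.instance Definition _ := bilinear_isBilinear.Build R
  'M[R]_(m, n) 'M[R]_(m, n) R *%R *%R (@frobdot R m n) frobdot_bilinear.

Lemma frobdot_sym A B : frobdot A B = (-1) ^+ false * idfun (frobdot B A).
Proof. by rewrite expr0 mul1r /= /frobdot -mxtrace_tr trmx_mul trmxK. Qed.

HB.instance Definition _ := isHermitianSesquilinear.Build R
  'M[R]_(m, n) false idfun (@frobdot R m n) frobdot_sym.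

Lemma frobdot_gt0 A : A != 0 -> 0 < frobdot A A.
Proof.
move=> A0; rewrite frobdotE lt_def; apply/andP; split; last first.
  by do 2![apply: sumr_ge0 => ? _]; rewrite -expr2 sqr_ge0.
apply: contra A0 => /eqP; rewrite pair_big /= => /psumr_eq0P A0.
apply/eqP/matrixP => i j; rewrite mxE; apply/eqP; rewrite -sqrf_eq0 expr2.
by rewrite (A0 _ (i, j)) // => k _; rewrite -expr2 sqr_ge0.
Qed.

HB.instance Definition _ := isDotProduct.Build R
  'M[R]_(m, n) (@frobdot R m n) frobdot_gt0.

End FrobeniusDot.

Section OrthogonalProjection.
Variables (R : rcfType) (m n : nat).
Implicit Types U : {vspace 'M[R]_(m, n)}.

Definition orthocompl U : {vspace 'M[R]_(m, n)} :=
  orthov (@frobdot R m n : {symmetric 'M[R]_(m, n)}) U.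

Definition orthoproj U : 'End('M[R]_(m, n)) := daddv_pi U (orthocompl U).

Lemma orthocomplP U A :
  reflect {in U, forall B, frobdot A B = 0} (A \in orthocompl U).
Proof. exact: (@mem_orthovP R false idfun _ (@frobdot R m n : {symmetric _})). Qed.

Lemma orthocompl_disj U : (U :&: orthocompl U = 0)%VS.
Proof.
apply/eqP; rewrite -subv0; apply/subvP => A; rewrite memv_cap memv0.
case/andP=> UA /orthocomplP/(_ A UA); apply: contra_eqT => A0.
by rewrite gt_eqF // frobdot_gt0.
Qed.

Lemma orthocompl_add U : (U + orthocompl U = fullv)%VS.
Proof.
pose f (A : 'M[R]_(m, n)) : 'rV[R]_(\dim U) := \row_i frobdot A (vbasis U)`_i.
have f_lin : linear f.
  move=> a A B; apply/rowP => i; rewrite !mxE.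
  by rewrite (frobdot_bilinear R m n).1.
pose fL : {linear 'M[R]_(m, n) -> 'rV[R]_(\dim U)} :=
  HB.pack f (GRing.isLinear.Build _ _ _ _ f f_lin).
have kerS : (lker (linfun fL) <= orthocompl U)%VS.
  apply/subvP => A; rewrite memv_ker lfunE => /eqP /rowP fA0.
  apply/orthocomplP => B /coord_vbasis ->; rewrite linear_sumr big1 // => i _.
  by have := fA0 i; rewrite !mxE linearZr /= => ->; rewrite mulr0.
apply/eqP; rewrite -(dimv_leqif_eq (subvf _)) eqn_leq dimvS ?subvf //=.
rewrite dimv_disjoint_sum ?orthocompl_disj //.
rewrite -(limg_ker_dim (linfun fL) fullv) capfv addnC leq_add ?dimvS //.
by rewrite (leq_trans (dimvS (subvf _))) // dimvf /dim /= mul1n.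
Qed.

Lemma orthoproj_mem U A : orthoproj U A \in U.
Proof. exact: memv_pi. Qed.

Lemma orthoproj_compl U A : A - orthoproj U A \in orthocompl U.
Proof.
have := daddv_pi_add (w := A) (orthocompl_disj U).
rewrite orthocompl_add memvf => /(_ isT) {1}<-.
by rewrite addrC addKr memv_pi.
Qed.

End OrthogonalProjection.

(* The shared degrees of freedom are numbered by 'I_p, in one fixed order; the *)
(* r-th one is row [tau r] and column [sigma r] of the response block.         *)
Section SharedPattern.
Variables (R : rcfType) (mT mS p : nat).
Variables (tau : 'I_p -> 'I_mT) (sigma : 'I_p -> 'I_mS).

Definition shared_block (A : 'M[R]_(mT, mS)) : 'M[R]_p := mxsub tau sigma A.

Definition shared_defect (A : 'M[R]_(mT, mS)) : 'M[R]_p :=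
  shared_block A - (shared_block A)^T.

Lemma shared_defect_linear : linear shared_defect.
Proof. by move=> a A B; apply/matrixP => r c; rewrite !mxE mulrBr opprD addrACA. Qed.

HB.instance Definition _ := GRing.isLinear.Build R
  'M[R]_(mT, mS) 'M[R]_p *:%R shared_defect shared_defect_linear.

Definition sym_space : {vspace 'M[R]_(mT, mS)} := lker (linfun shared_defect).

Lemma sym_spaceP (A : 'M[R]_(mT, mS)) :
  reflect (forall r c, A (tau r) (sigma c) = A (tau c) (sigma r))
          (A \in sym_space).
Proof.
rewrite memv_ker lfunE subr_eq0; apply: (iffP eqP) => [/matrixP A_sym r c|A_sym].
  by have := A_sym r c; rewrite !mxE.
by apply/matrixP => r c; rewrite !mxE.
Qed.

Definition antisym_space : {vspace 'M[R]_(mT, mS)} := orthocompl sym_space.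

End SharedPattern.

Definition rot90 (R : rcfType) (v : 'rV[R]_2) : 'rV[R]_2 :=
  \row_c (if c == 0 then - v 0 1 else v 0 0).

(* Infinitesimal rigid motion: translation [t] plus rotation of rate [w]. *)
Definition rigid_motion (R : rcfType) (N : nat) (x : 'I_N -> 'rV[R]_2)
    (t : 'rV[R]_2) (w : R) : 'M[R]_(N, 2) :=
  \matrix_(i, c) (t + w *: rot90 (x i)) 0 c.

(* [bond b = (i, j)] is the oriented bond from node i to node j.               *)
(* The degree of freedom of node [i] along axis [c] is [mxvec_index i c], so   *)
(* that a displacement field, an N x 2 matrix, becomes a vector via [mxvec].   *)
(* [pinnedP] says that pinning removes the planar rigid-body modes.            *)
Record network (R : rcfType) := Network {
  nnodes : nat;
  nbonds : nat;
  pos : 'I_nnodes -> 'rV[R]_2;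
  bond : 'I_nbonds -> 'I_nnodes * 'I_nnodes;
  odd_coupling : 'I_nbonds -> R;
  pinned : {set 'I_(nnodes * 2)};
  bond_length_gt0 :
    forall b, 0 < frobnorm (pos (bond b).2 - pos (bond b).1);
  card_pinned : #|pinned| = 3;
  pinnedP : forall (t : 'rV[R]_2) (w : R),
    (forall i c, mxvec_index i c \in pinned -> rigid_motion pos t w i c = 0) ->
    rigid_motion pos t w = 0
}.

Section Network.
Variables (R : rcfType) (net : network R).

Local Notation N := (nnodes net).
Local Notation nb := (nbonds net).

Definition bond_length (b : 'I_nb) : R :=
  frobnorm (pos (bond b).2 - pos (bond b).1).

Definition bond_normal (b : 'I_nb) : 'rV[R]_2 :=
  (bond_length b)^-1 *: (pos (bond b).2 - pos (bond b).1).

Definition bond_tangent (b : 'I_nb) : 'rV[R]_2 := rot90 (bond_normal b).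

Definition bond_vector (v : 'rV[R]_2) (b : 'I_nb) : 'cV[R]_(N * 2) :=
  (mxvec (\matrix_(l, c) (if l == (bond b).1 then - v 0 c
                          else if l == (bond b).2 then v 0 c else 0)))^T.

Definition q_vec (b : 'I_nb) := bond_vector (bond_normal b) b.
Definition s_vec (b : 'I_nb) := bond_vector (bond_tangent b) b.

Definition stiffness (k : 'I_nb -> R) : 'M[R]_(N * 2) :=
  \sum_b (k b *: q_vec b + odd_coupling b *: s_vec b) *m (q_vec b)^T.

Definition nfree : nat := #|~: pinned net|.

Lemma nfreeE : nfree = (2 * N - 3)%N.
Proof. by rewrite /nfree cardsCs setCK card_ord card_pinned mulnC. Qed.

Definition free_dof : 'I_nfree -> 'I_(N * 2) := enum_val.

Definition Kff (k : 'I_nb -> R) : 'M[R]_nfree :=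
  mxsub free_dof free_dof (stiffness k).

Definition compliance (k : 'I_nb -> R) : 'M[R]_nfree := invmx (Kff k).

Definition admissible (k : 'I_nb -> R) : Prop :=
  (forall b, 0 < k b) /\ Kff k \in unitmx.

Definition posdef n (A : 'M[R]_n) : Prop :=
  A^T = A /\ forall u : 'cV[R]_n, u != 0 -> 0 < (u^T *m A *m u) 0 0.

Definition passive (k : 'I_nb -> R) : Prop :=
  (forall b : 'I_nb, odd_coupling b = 0) /\ posdef (Kff k).

Definition reciprocal : Prop :=
  forall k, admissible k -> (Kff k)^T = Kff k /\ Kff k \in unitmx.

Definition response (k : 'I_nb -> R) (mT mS : nat)
    (eT : 'I_mT -> 'I_nfree) (eS : 'I_mS -> 'I_nfree) : 'M[R]_(mT, mS) :=
  mxsub eT eS (compliance k).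

End Network.

Definition enumerates (n : nat) (D : finType) (e : 'I_n -> D) (A : {set D}) :=
  injective e /\ [set e i | i : 'I_n] = A.

(* Main.v *)
(** A symmetric [K_ff] has a symmetric inverse, so every reachable block lies
    in [S_P].  The residual therefore has the same [A_P]-component as the
    target up to sign, and an orthogonal projection does not increase the
    norm.  For an explicit form of the projection, place [(B - B^T)/2] at the
    rows [tau] and columns [sigma] of a zero block: by injectivity this
    placement is an isometry, adjoint to restriction to the shared block. *)
Require Import Defs.
From mathcomp Require Import all_boot all_order all_algebra.
From mathcomp Require Import reals.

Import Order.TTheory GRing.Theory Num.Theory.
Local Open Scope ring_scope.

Lemma frobdotC (R : rcfType) (m n : nat) (A B : 'M[R]_(m, n)) :
  frobdot A B = frobdot B A.
Proof. by rewrite frobdot_sym expr0 mul1r. Qed.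

Lemma frobdot_ge0 (R : rcfType) (m n : nat) (A : 'M[R]_(m, n)) :
  0 <= frobdot A A.
Proof.
by have [->|/frobdot_gt0/ltW//] := eqVneq A 0; rewrite /frobdot mulmx0 mxtrace0.
Qed.

Lemma frobnormN (R : rcfType) (m n : nat) (A : 'M[R]_(m, n)) :
  frobnorm (- A) = frobnorm A.
Proof. by rewrite /frobnorm linearNl linearNr opprK. Qed.

Lemma frobnormZ (R : rcfType) (m n : nat) (a : R) (A : 'M[R]_(m, n)) :
  frobnorm (a *: A) = `|a| * frobnorm A.
Proof.
rewrite /frobnorm linearZl_LR linearZr_LR /= mulrA -expr2.
by rewrite sqrtrM ?sqr_ge0 // sqrtr_sqr.
Qed.

(** Uniqueness of the orthogonal decomposition: two candidates differ by an element of [U] that is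
    also in [orthocompl U], hence by zero. *)
Lemma orthoproj_eq (R : rcfType) (m n : nat) (U : {vspace 'M[R]_(m, n)})
    (A X : 'M[R]_(m, n)) :
  X \in U -> A - X \in orthocompl U -> orthoproj U A = X.
Proof.
move=> UX UcAX; apply/eqP; rewrite -subr_eq0 -memv0 -(orthocompl_disj U).
rewrite memv_cap rpredB ?orthoproj_mem //=.
have -> : orthoproj U A - X = (A - X) - (A - orthoproj U A).
  by rewrite opprB [RHS]addrC addrA subrK.
by rewrite rpredB // orthoproj_compl.
Qed.

Lemma orthoproj_orthocompl (R : rcfType) (m n : nat)
    (U : {vspace 'M[R]_(m, n)}) (A : 'M[R]_(m, n)) :
  A \in orthocompl U -> orthoproj U A = 0.
Proof. by move=> UcA; apply: orthoproj_eq; rewrite ?mem0v ?subr0. Qed.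

Lemma sub_orthocomplK (R : rcfType) (m n : nat) (U : {vspace 'M[R]_(m, n)}) :
  (U <= orthocompl (orthocompl U))%VS.
Proof.
apply/subvP => A UA; apply/orthocomplP => B /orthocomplP BU.
by rewrite frobdotC BU.
Qed.

(** Pythagoras: the projection and the remainder are orthogonal, so the squared norms add. *)
Lemma le_frobnorm_orthoproj (R : rcfType) (m n : nat)
    (U : {vspace 'M[R]_(m, n)}) (A : 'M[R]_(m, n)) :
  frobnorm (orthoproj U A) <= frobnorm A.
Proof.
rewrite /frobnorm ler_sqrt ?frobdot_ge0 //.
have /orthocomplP/(_ _ (orthoproj_mem U A)) := orthoproj_compl U A.
have -> : frobdot A A = frobdot (orthoproj U A + (A - orthoproj U A))
                                (orthoproj U A + (A - orthoproj U A)).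
  by rewrite addrC subrK.
move: (orthoproj U A) (A - orthoproj U A) => X Y YX.
rewrite linearDl !linearDr /= (frobdotC _ _ _ X Y) YX addr0 add0r.
by rewrite lerDl frobdot_ge0.
Qed.

Section SharedEmbedding.
Variables (R : rcfType) (mT mS p : nat).
Variables (tau : 'I_p -> 'I_mT) (sigma : 'I_p -> 'I_mS).

(** The rows of [rowsub tau 1%:M] are the unit vectors at the positions [tau r]. As a matrix
    product, the placement has its adjoint given by cyclicity of the trace. *)
Definition shared_embed (M : 'M[R]_p) : 'M[R]_(mT, mS) :=
  (rowsub tau 1%:M)^T *m M *m rowsub sigma 1%:M.

Lemma shared_blockE (A : 'M[R]_(mT, mS)) :
  shared_block tau sigma A = rowsub tau 1%:M *m A *m (rowsub sigma 1%:M)^T.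
Proof.
rewrite mul_rowsub_mx mul1mx -[RHS]trmxK trmx_mul trmxK mul_rowsub_mx mul1mx.
by apply/matrixP => r c; rewrite !mxE.
Qed.

Lemma tr_shared_defect (A : 'M[R]_(mT, mS)) :
  (shared_defect tau sigma A)^T = - shared_defect tau sigma A.
Proof. by rewrite linearB /= trmxK opprB. Qed.

Lemma frobdot_shared_embed (M : 'M[R]_p) (A : 'M[R]_(mT, mS)) :
  frobdot (shared_embed M) A = frobdot M (shared_block tau sigma A).
Proof.
rewrite shared_blockE /frobdot /shared_embed !trmx_mul trmxK.
by rewrite -!mulmxA mxtrace_mulC !mulmxA.
Qed.

Hypotheses (tau_inj : injective tau) (sigma_inj : injective sigma).

(** Injectivity makes the rows of each selection matrix orthonormal. *)
Lemma shared_embedK : cancel shared_embed (shared_block tau sigma).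
Proof.
have rowsub_orth n (f : 'I_p -> 'I_n) :
    injective f -> rowsub f 1%:M *m (rowsub f 1%:M)^T = 1%:M :> 'M[R]_p.
  move=> f_inj; rewrite mul_rowsub_mx mul1mx.
  by apply/matrixP => r c; rewrite !mxE (inj_eq f_inj) eq_sym.
move=> M; rewrite shared_blockE /shared_embed !mulmxA rowsub_orth // mul1mx.
by rewrite -mulmxA rowsub_orth // mulmx1.
Qed.

Lemma frobnorm_shared_embed (M : 'M[R]_p) :
  frobnorm (shared_embed M) = frobnorm M.
Proof. by rewrite /frobnorm frobdot_shared_embed shared_embedK. Qed.

Lemma shared_embed_antisym (M : 'M[R]_p) :
  M^T = - M -> shared_embed M \in antisym_space R tau sigma.
Proof.
move=> M_anti; apply/orthocomplP => A /sym_spaceP A_sym.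
rewrite frobdot_shared_embed; set B := shared_block _ _ _.
have B_sym : B^T = B by apply/matrixP => r c; rewrite !mxE.
(* Transposing inside the trace shows that the pairing of antisymmetric [M] with symmetric [B]
   equals its own negative. *)
apply/eqP; rewrite -eqNr; apply/eqP.
rewrite /frobdot -[in RHS]mxtrace_tr trmx_mul trmxK B_sym mxtrace_mulC.
by rewrite M_anti mulmxN raddfN opprK.
Qed.

Lemma orthoproj_antisym_space (A : 'M[R]_(mT, mS)) :
  orthoproj (antisym_space R tau sigma) A =
  shared_embed (2^-1 *: shared_defect tau sigma A).
Proof.
apply: orthoproj_eq.
  by apply: shared_embed_antisym; rewrite linearZ /= tr_shared_defect scalerN.
(* It suffices that the remainder lies in [sym_space]. With [D] the antisymmetric defect of [A], the
   embedded block [D/2] has defect [D/2 - (D/2)^T = D], which cancels that of [A]. *)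
apply: (subvP (sub_orthocomplK _ _ _ _)).
rewrite memv_ker lfunE /= linearB /= subr_eq0; apply/eqP.
rewrite [RHS]/shared_defect shared_embedK linearZ /= tr_shared_defect.
by rewrite scalerN opprK -scalerDl -[2^-1]mul1r -splitr scale1r.
Qed.

End SharedEmbedding.

(** The odd couplings belong to the network, so their vanishing, read off at one [k], leaves a sum
    of symmetric terms [k' b *: q q^T] at every [k']. *)
Lemma passive_reciprocal (R : rcfType) (net : network R)
    (k : 'I_(nbonds net) -> R) :
  passive k -> reciprocal net.
Proof.
move=> [a0 _] k' [_ Ku]; split=> //; rewrite /Kff trmx_mxsub; congr mxsub.
rewrite /stiffness linear_sum; apply: eq_bigr => b _ /=.
by rewrite a0 scale0r addr0 trmx_mul trmxK linearZ /= -scalemxAl -scalemxAr.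
Qed.

(** On shared degrees of freedom, the two entries compared are transposed entries of the symmetric
    compliance. *)
Lemma response_sym_space (R : rcfType) (net : network R)
    (k : 'I_(nbonds net) -> R) (mT mS p : nat)
    (tau : 'I_p -> 'I_mT) (sigma : 'I_p -> 'I_mS)
    (eT : 'I_mT -> 'I_(nfree net)) (eS : 'I_mS -> 'I_(nfree net)) :
  (Kff k)^T = Kff k -> (forall r, eT (tau r) = eS (sigma r)) ->
  response k eT eS \in sym_space R tau sigma.
Proof.
move=> K_sym eTS; have C_sym : (compliance k)^T = compliance k.
  by rewrite /compliance trmx_inv K_sym.
by apply/sym_spaceP => r c; rewrite !mxE !eTS -[in LHS]C_sym mxE.
Qed.

Theorem theorem2 (R : realType) (mT mS p : nat)
    (tau : 'I_p -> 'I_mT) (sigma : 'I_p -> 'I_mS)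
    (tau_inj : injective tau) (sigma_inj : injective sigma)
    (Rstar : 'M[R]_(mT, mS)) :
  let PiRstar := orthoproj (antisym_space R tau sigma) Rstar in
  let B := shared_block tau sigma Rstar in
  [/\ forall (net : network R) (k : 'I_(nbonds net) -> R),
        passive k -> reciprocal net,
      forall net : network R, reciprocal net ->
      forall (S T : {set 'I_(nfree net)})
             (eT : 'I_mT -> 'I_(nfree net)) (eS : 'I_mS -> 'I_(nfree net))
             (eP : 'I_p -> 'I_(nfree net)),
        enumerates eT T -> enumerates eS S -> enumerates eP (T :&: S) ->
        (forall r, eT (tau r) = eP r) -> (forall r, eS (sigma r) = eP r) ->
      forall k : 'I_(nbonds net) -> R, admissible k ->
        frobnorm (response k eT eS - Rstar) >= frobnorm PiRstar
    & frobnorm PiRstar = 2^-1 * frobnorm (B - B^T)].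
Proof.
move=> PiRstar B; split=> [net k|net net_recip S T eT eS eP _ _ _ eTP eSP k k_adm|].
- exact: passive_reciprocal.
- have [K_sym _] := net_recip k k_adm.
  have R_sym : response k eT eS \in sym_space R tau sigma.
    by apply: response_sym_space => // r; rewrite eTP eSP.
  (* The projection annihilates the response, so the residual projects to [- PiRstar], whatever [k]
     is. *)
  have <- : frobnorm (orthoproj (antisym_space R tau sigma)
                        (response k eT eS - Rstar)) = frobnorm PiRstar.
    rewrite linearB /= orthoproj_orthocompl ?sub0r ?frobnormN //.
    exact: (subvP (sub_orthocomplK _ _ _ _)).
  exact: le_frobnorm_orthoproj.
- rewrite /PiRstar orthoproj_antisym_space // frobnorm_shared_embed //.
  by rewrite frobnormZ ger0_norm // invr_ge0 ler0n.
Qed.
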